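(* Two kite graphs $K_{n_1}^{n_2}$ and $K_{n_1'}^{n_2'}$ are isomorphic if and only if they have the same path sequence.
   Context: Graphs are finite and simple. A path of length $h$ in $G$ is a subgraph that is a path with $h$ edges ($h+1$ distinct vertices); paths are undirected, and paths of length $0$ are single vertices. $P_h(G)$ is the number of paths of length $h$ in $G$. The path sequence of $G$ is $P(G)=(P_0(G),P_1(G),\ldots,P_\rho(G))$, where $\rho=\rho(G)$ is the length of a longest path in $G$. The kite graph $K_{n_1}^{n_2}$ ($n_1\ge1$, $n_2\ge2$) is obtained from the complete graph $K_{n_1}$ on $n_1$ vertices and the path $P_{n_2}$ on $n_2$ vertices by identifying one vertex of $K_{n_1}$ with a pendant (end) vertex $x$ of $P_{n_2}$; thus it has $n_1+n_2-1$ vertices and $x$ has degree $n_1$ in it. *)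

(* Defs.v *)
From mathcomp Require Import all_boot.

Set Implicit Arguments.
Unset Strict Implicit.
Unset Printing Implicit Defensive.

Record sgraph := SGraph {
  vertex :> finType;
  adj : rel vertex;
  adj_sym : symmetric adj;
  adj_irrefl : irreflexive adj }.

Definition isomorphic (G H : sgraph) : Prop :=
  exists2 f : G -> H, bijective f & forall x y : G, adj (f x) (f y) = adj x y.

(* A path of length h is a subgraph, i.e. a pair (vertex set, edge set) with
   edges as 2-element sets, and not a traversal: the two traversals of a path
   with h > 0 give the same pair. *)

Definition path_subgraph (G : sgraph) (s : seq G) : {set G} * {set {set G}} :=
  ([set x in s], [set [set e.1; e.2] | e in zip s (behead s)]).

Definition is_path (G : sgraph) (h : nat) (S : {set G} * {set {set G}}) : bool :=
  [exists t : h.+1.-tuple G,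
    [&& uniq t, sorted (@adj G) t & S == path_subgraph t]].

Definition num_paths (G : sgraph) (h : nat) : nat :=
  #|[set S : {set G} * {set {set G}} | is_path h S]|.

(* The bound h < #|G| loses nothing: a path of length h has h + 1 vertices. *)
Definition longest_path_length (G : sgraph) : nat :=
  \max_(h < #|G| | 0 < num_paths G h) h.

Definition path_sequence (G : sgraph) : seq nat :=
  mkseq (num_paths G) (longest_path_length G).+1.

Section CompleteGraph.
Variable n : nat.

Definition complete_adj : rel 'I_n := fun i j => i != j.

Lemma complete_adj_sym : symmetric complete_adj.
Proof. by move=> i j; rewrite /complete_adj eq_sym. Qed.

Lemma complete_adj_irrefl : irreflexive complete_adj.
Proof. by move=> i; rewrite /complete_adj eqxx. Qed.

Definition complete_graph : sgraph :=
  SGraph complete_adj_sym complete_adj_irrefl.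

End CompleteGraph.

Section PathGraph.
Variable n : nat.

Definition consecutive : rel 'I_n :=
  fun i j => (i.+1 == j :> nat) || (j.+1 == i :> nat).

Lemma consecutive_sym : symmetric consecutive.
Proof. by move=> i j; rewrite /consecutive orbC. Qed.

Lemma consecutive_irrefl : irreflexive consecutive.
Proof. by move=> i; rewrite /consecutive orbb gtn_eqF. Qed.

(* n vertices, hence n - 1 edges. *)
Definition path_graph : sgraph := SGraph consecutive_sym consecutive_irrefl.

End PathGraph.

(* The graph obtained from the disjoint union of G and H by identifying u with
   v; the merged vertex is represented by inl u. *)
Section Coalescence.
Variables (G H : sgraph) (u : G) (v : H).

Definition coalescence_vertex : finType := (G + {y : H | y != v})%type.

Definition coalescence_adj : rel coalescence_vertex := fun a b =>
  match a, b with
  | inl x, inl y => adj x y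
  | inl x, inr y => (x == u) && adj v (val y)
  | inr x, inl y => (y == u) && adj v (val x)
  | inr x, inr y => adj (val x) (val y)
  end.

Lemma coalescence_adj_sym : symmetric coalescence_adj.
Proof. by move=> [x|x] [y|y] //=; rewrite adj_sym. Qed.

Lemma coalescence_adj_irrefl : irreflexive coalescence_adj.
Proof. by move=> [x|x] /=; rewrite adj_irrefl. Qed.

Definition coalescence : sgraph :=
  SGraph coalescence_adj_sym coalescence_adj_irrefl.

End Coalescence.

(* Vertex 0 is an end of path_graph n2; which vertex of the complete graph is
   chosen is immaterial up to isomorphism. *)
Definition kite (n1 n2 : nat) (n1_ge1 : 1 <= n1) (n2_ge2 : 2 <= n2) : sgraph :=
  @coalescence (complete_graph n1) (path_graph n2)
    (Ordinal n1_ge1) (Ordinal (ltnW n2_ge2)).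

(* Main.v *)
Require Import Defs.
From mathcomp Require Import all_boot zify.

(** The order and the size of a kite determine it: a + b - 1 and
   'C(a, 2) + b - 1 determine a (a - 3), hence a unless {a, a'} = {1, 2}, and
   in that exceptional case both kites are the path with b vertices (a = 1). *)

Set Implicit Arguments.
Unset Strict Implicit.
Unset Printing Implicit Defensive.

(** * Isomorphisms preserve the path sequence *)

Lemma isomorphic_refl (G : sgraph) : isomorphic G G.
Proof. by exists id => //; exists id. Qed.

Lemma isomorphic_sym (G H : sgraph) : isomorphic G H -> isomorphic H G.
Proof.
case=> f [g fK gK] f_adj; exists g; first by exists f.
by move=> x y; rewrite -f_adj !gK.
Qed.

Lemma isomorphic_trans (G H K : sgraph) :
  isomorphic G H -> isomorphic H K -> isomorphic G K.
Proof.
case=> f f_bij f_adj [g g_bij g_adj]; exists (g \o f); first exact: bij_comp.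
by move=> x y; rewrite /= g_adj f_adj.
Qed.

Lemma inj_card_isomorphic (G H : sgraph) (f : G -> H) :
    injective f -> #|H| <= #|G| ->
    (forall x y, adj (f x) (f y) = adj x y) -> isomorphic G H.
Proof. by move=> f_inj le_HG f_adj; exists f => //; apply: inj_card_bij. Qed.

Lemma path_subgraph_map (G H : sgraph) (f : G -> H) (s : seq G) :
  path_subgraph (map f s) =
  (f @: (path_subgraph s).1, (fun e : {set G} => f @: e) @: (path_subgraph s).2).
Proof.
congr pair; apply/setP=> z.
  rewrite inE; apply/mapP/imsetP => -[x xs ->]; exists x => //.
    by rewrite inE.
  by rewrite inE in xs.
have -> : zip (map f s) (behead (map f s)) =
    [seq (f e.1, f e.2) | e <- zip s (behead s)].
  rewrite behead_map; elim: s (behead s) => [|x s IHs] [|y t] //=.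
  by rewrite IHs.
apply/imsetP/imsetP.
  case=> e /mapP[e' e'_in ->] -> /=; exists [set e'.1; e'.2].
    by apply/imsetP; exists e'.
  by rewrite imsetU1 imset_set1.
case=> _ /imsetP[e e_in ->] ->; exists (f e.1, f e.2).
  by apply/mapP; exists e.
by rewrite imsetU1 imset_set1.
Qed.

(** An induced embedding acts injectively on pairs (vertex set, edge set) and carries paths to
    paths. Applied to an isomorphism and to its inverse, this yields equality. *)
Lemma leq_num_paths (G H : sgraph) (f : G -> H) (h : nat) :
    injective f -> (forall x y, adj (f x) (f y) = adj x y) ->
  num_paths G h <= num_paths H h.
Proof.
move=> f_inj f_adj.
pose F (S : {set G} * {set {set G}}) :=
  (f @: S.1, (fun e : {set G} => f @: e) @: S.2).
have F_inj : injective F.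
  move=> [V E] [V' E'] [/(imset_inj f_inj)-> eqE]; congr pair.
  exact: (imset_inj (imset_inj f_inj)) eqE.
rewrite /num_paths -(card_imset _ F_inj); apply: subset_leq_card.
apply/subsetP=> S' /imsetP[S + ->]; rewrite !inE.
case/existsP=> t /and3P[t_uniq t_path /eqP->].
apply/existsP; exists (map_tuple f t).
rewrite map_inj_uniq // t_uniq path_subgraph_map eqxx andbT /=.
rewrite sorted_map; apply: sub_sorted t_path => x y /=.
by rewrite f_adj.
Qed.

Lemma isomorphic_num_paths (G H : sgraph) :
  isomorphic G H -> num_paths G =1 num_paths H.
Proof.
case=> f [g fK gK] f_adj h; apply/eqP; rewrite eqn_leq.
rewrite (leq_num_paths _ (can_inj fK)) // (leq_num_paths _ (can_inj gK)) //.
by move=> x y; rewrite -f_adj !gK.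
Qed.

Lemma isomorphic_path_sequence (G H : sgraph) :
  isomorphic G H -> path_sequence G = path_sequence H.
Proof.
move=> isoGH; have eqP := isomorphic_num_paths isoGH.
(* The maximum in [longest_path_length] ranges over h < #|G|, so the index types have to be matched
   first. *)
have eq_card : #|G| = #|H|.
  by case: isoGH => f [g fK gK] _; apply: bij_eq_card; exists g; eassumption.
have eq_rho : longest_path_length G = longest_path_length H.
  by rewrite /longest_path_length eq_card; apply: eq_bigl => h; rewrite eqP.
by rewrite /path_sequence eq_rho; apply: eq_mkseq.
Qed.

(** * Order and size as the first two entries of the path sequence *)

Lemma num_paths0 (G : sgraph) : num_paths G 0 = #|G|.
Proof.
have F_inj : injective (fun x : G => path_subgraph [:: x]).
  move=> x y [/setP/(_ x)]; rewrite !inE eqxx => /esym/eqP->.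
  by [].
rewrite /num_paths -cardsT -(card_imset _ F_inj); apply: eq_card => S.
rewrite inE; apply/existsP/imsetP.
  by case=> -[[|x []] // ?] /and3P[_ _ /eqP->]; exists x.
by case=> x _ ->; exists [tuple x]; rewrite /= eqxx.
Qed.

(** Twice the number of edges. Counting ordered pairs gives a plain double sum, which splits along
    the vertex set of a coalescence. *)
Definition num_arcs (G : sgraph) : nat := \sum_(x : G) \sum_(y : G) adj x y.

Lemma path_subgraph_edge_eq (G : sgraph) (x y x' y' : G) : x != y ->
  (path_subgraph [:: x'; y'] == path_subgraph [:: x; y]) =
  ((x', y') \in [set (x, y); (y, x)]).
Proof.
move=> xy; apply/eqP/set2P; last first.
  case=> -[-> ->] //; congr pair; apply/setP=> z.
    by rewrite !inE orbC.
  by apply/imsetP/imsetP=> -[e]; rewrite inE => /eqP-> ->;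
     (eexists; [apply: mem_head | rewrite /= setUC]).
(* The vertex sets alone decide; [x != y] excludes x' = y'. *)
case=> /setP eqV _; move: (eqV x') (eqV y') (eqV x) (eqV y).
rewrite !inE !eqxx !orbT /=.
case/esym/orP=> /eqP-> /esym/orP[]/eqP->; rewrite ?eqxx ?orbb; auto.
  by rewrite (eq_sym y x) (negbTE xy).
by rewrite (negbTE xy).
Qed.

Lemma num_arcs_paths1 (G : sgraph) : num_arcs G = num_paths G 1 * 2.
Proof.
pose F (p : G * G) := path_subgraph [:: p.1; p.2].
rewrite /num_arcs pair_big /= -big_mkcond /=.
(* Arcs are grouped by the path they span; each group is {(x, y), (y, x)}. *)
rewrite (partition_big F (mem [set S | is_path 1 S])) /=; last first.
  move=> [x y] /= xy; rewrite inE; apply/existsP; exists [tuple x; y].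
  rewrite /= xy inE eqxx !andbT; apply: contraTneq xy => ->.
  by rewrite adj_irrefl.
rewrite /num_paths -sum_nat_const; apply: eq_bigr => S; rewrite inE.
case/existsP=> -[[|x [|y []]] // ?] /and3P[/=]; rewrite inE !andbT.
move=> xy adj_xy /eqP->; rewrite sum1_card.
have <- : #|[set (x, y); (y, x)]| = 2.
  by rewrite cards2 xpair_eqE (negbTE xy).
apply: eq_card => -[x' y']; rewrite unfold_in /F path_subgraph_edge_eq //.
rewrite andb_idl // => /set2P[][-> ->] //=.
by rewrite adj_sym.
Qed.

(** An edge forces a longest path of length at least 1, so entries 0 and 1 are genuine path counts
    and not the default value of [nth]. *)
Lemma path_sequence_prefix (G H : sgraph) :
    0 < num_arcs G -> 0 < num_arcs H -> path_sequence G = path_sequence H ->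
  #|G| = #|H| /\ num_arcs G = num_arcs H.
Proof.
have rho_gt0 K : 0 < num_arcs K -> 0 < longest_path_length K.
  rewrite num_arcs_paths1 muln_gt0 andbT => P1.
  have K_gt1 : 1 < #|K|.
    case/card_gt0P: (P1) => S; rewrite inE => /existsP[t /andP[t_uniq _]].
    by rewrite -(size_tuple t) -(card_uniqP t_uniq) max_card.
  exact: (@leq_bigmax_cond _ _ (fun h : 'I_#|K| => h : nat) (Ordinal K_gt1)).
move=> /rho_gt0 G_gt0 /rho_gt0 H_gt0 eqGH.
rewrite !num_arcs_paths1 -!num_paths0.
have /(congr1 (nth 0 ^~ 0)) := eqGH; have /(congr1 (nth 0 ^~ 1)) := eqGH.
by rewrite !nth_mkseq // => -> ->.
Qed.

(** * Order and size of a kite *)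

Lemma num_arcs_complete_graph (n : nat) :
  num_arcs (complete_graph n) = n * n.-1.
Proof.
rewrite /num_arcs -[n in RHS]card_ord -sum_nat_const; apply: eq_bigr => i _.
rewrite -big_mkcond sum1_card; transitivity #|predC1 i|.
  by apply: eq_card => j; rewrite !inE eq_sym.
by rewrite cardC1 card_ord.
Qed.

Lemma num_arcs_path_graph (n : nat) : num_arcs (path_graph n) = n.-1 * 2.
Proof.
have succ_count : \sum_(i < n) \sum_(j < n) (i.+1 == j) = n.-1.
  case: n => [|n]; first by rewrite big_ord0.
  rewrite big_ord_recr /= [X in _ + X]big1 => [|j _]; last first.
    by rewrite gtn_eqF.
  rewrite addn0 -[RHS]card_ord -sum1_card; apply: eq_bigr => i _.
  rewrite (bigD1 (lift ord0 i)) //= eqxx big1 // => j.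
  by rewrite -val_eqE /= eq_sym => /negbTE->.
(* One copy of the double sum counts forward arcs; the other, transposed, counts backward arcs. No
   pair is both, so the disjunction becomes a sum. *)
rewrite muln2 -addnn -{1}succ_count -succ_count [X in _ + X]exchange_big.
rewrite -big_split; apply: eq_bigr => i _; rewrite -big_split.
by apply: eq_bigr => j _ /=; rewrite /consecutive; case: eqP; case: eqP; lia.
Qed.

Section Coalescence.
Variables (G H : sgraph) (u : G) (v : H).

Lemma card_coalescence : #|coalescence u v| = #|G| + #|H|.-1.
Proof. by rewrite card_sum card_sig -(cardC1 v). Qed.

(** The merged vertex [inl u] takes over all arcs at [v], and none is lost since [v] has no loop. *)
Lemma num_arcs_coalescence :
  num_arcs (coalescence u v) = num_arcs G + num_arcs H.
Proof.
have sumH (F : H -> nat) :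
    \sum_(y : H) F y = F v + \sum_(y : {y : H | y != v}) F (val y).
  rewrite (bigD1 v) //=; congr (_ + _).
  exact: (big_sub [pred y | y != v]).
rewrite {1 3}/num_arcs big_sumType sumH.
under eq_bigr do rewrite big_sumType /=.
under [X in _ + X = _]eq_bigr do rewrite big_sumType /=.
rewrite big_split /= -!addnA; congr (_ + _).
(* Arcs from [G] to the rest of [H] start at [u] only: they form the row of [v], whose diagonal
   entry is 0. *)
rewrite exchange_big sumH adj_irrefl add0n /=; congr (_ + _).
  apply: eq_bigr => y _; rewrite (bigD1 u) //= eqxx big1 ?addn0 //.
  by move=> x /negbTE->.
apply: eq_bigr => x _; rewrite sumH; congr (_ + _).
rewrite (bigD1 u) //= eqxx big1 ?addn0 1?adj_sym // => y /negbTE->.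
by [].
Qed.

End Coalescence.

Lemma card_kite (a b : nat) (a_ge1 : 1 <= a) (b_ge2 : 2 <= b) :
  #|kite a_ge1 b_ge2| = a + b.-1.
Proof. by rewrite card_coalescence !card_ord. Qed.

Lemma num_arcs_kite (a b : nat) (a_ge1 : 1 <= a) (b_ge2 : 2 <= b) :
  num_arcs (kite a_ge1 b_ge2) = a * a.-1 + b.-1 * 2.
Proof.
by rewrite num_arcs_coalescence num_arcs_complete_graph num_arcs_path_graph.
Qed.

(** * The kites that are paths *)

Lemma kite1_path_graph (b : nat) (one_ge1 : 1 <= 1) (b_ge2 : 2 <= b) :
  isomorphic (kite one_ge1 b_ge2) (path_graph b).
Proof.
pose f (x : kite one_ge1 b_ge2) : path_graph b :=
  match x with inl _ => Ordinal (ltnW b_ge2) | inr y => val y end.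
apply: (@inj_card_isomorphic _ _ f).
- move=> [x|x] [y|y] /=; first by rewrite (ord1 x) (ord1 y).
  + by case/esym/(elimN eqP (valP y)).
  + by case/(elimN eqP (valP x)).
  + by move=> /val_inj->.
- by rewrite card_kite card_ord; lia.
- move=> [x|x] [y|y] //=.
  + by rewrite (ord1 x) (ord1 y).
  + by rewrite (ord1 x).
  + by rewrite (ord1 y) consecutive_sym.
Qed.

(** The edge of the complete graph on two vertices prolongs the path by one vertex beyond its
    end. *)
Lemma kite2_path_graph (b : nat) (two_ge1 : 1 <= 2) (b_ge2 : 2 <= b) :
  isomorphic (kite two_ge1 b_ge2) (path_graph b.+1).
Proof.
(* The merged vertex 0 goes to position 1, the free vertex 1 to the new end 0, and the rest of the
   path is shifted by one. *)
pose f (x : kite two_ge1 b_ge2) : path_graph b.+1 :=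
  match x with inl i => inord (1 - i) | inr y => lift ord0 (val y) end.
have f_inl (i : 'I_2) : f (inl i) = 1 - i :> nat by rewrite inordK //; lia.
apply: (@inj_card_isomorphic _ _ f).
- move=> [x|x] [y|y] /(congr1 val); rewrite /= ?f_inl /= ?/bump /=.
  + move: (ltn_ord x) (ltn_ord y) => x_lt2 y_lt2 eq_xy.
    by congr inl; apply: val_inj => /=; lia.
  + by have := valP y; rewrite -val_eqE /=; lia.
  + by have := valP x; rewrite -val_eqE /=; lia.
  + by case=> /val_inj/val_inj->.
- by rewrite card_kite card_ord; lia.
- move=> [x|x] [y|y]; rewrite /= /consecutive ?f_inl /= ?/bump /=.
  + move: (ltn_ord x) (ltn_ord y).
    by rewrite /complete_adj -val_eqE /=; lia.
  + by have := valP y; rewrite -!val_eqE /=; lia.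
  + by have := valP x; rewrite -!val_eqE /=; lia.
  + by lia.
Qed.

Theorem corollary9 (n1 n2 n1' n2' : nat)
    (n1_ge1 : 1 <= n1) (n2_ge2 : 2 <= n2)
    (n1'_ge1 : 1 <= n1') (n2'_ge2 : 2 <= n2') :
  isomorphic (kite n1_ge1 n2_ge2) (kite n1'_ge1 n2'_ge2) <->
  path_sequence (kite n1_ge1 n2_ge2) = path_sequence (kite n1'_ge1 n2'_ge2).
Proof.
split; first exact: isomorphic_path_sequence.
case/path_sequence_prefix; [by rewrite num_arcs_kite; lia.. | ].
rewrite !card_kite !num_arcs_kite => eq_order eq_arcs.
(* Eliminating n2 and n2' leaves (n1 - n1') (n1 + n1' - 3) = 0, where n1 and n1' are positive. *)
have /or3P[/eqP eq_n1 | /andP[/eqP n1E /eqP n1'E] | /andP[/eqP n1E /eqP n1'E]] :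
  [|| n1 == n1', (n1 == 1) && (n1' == 2) | (n1 == 2) && (n1' == 1)] by nia.
- have eq_n2 : n2 = n2' by lia.
  (* The two kites still differ in the proofs of their bounds. *)
  subst n1' n2'; rewrite (bool_irrelevance n1_ge1 n1'_ge1).
  by rewrite (bool_irrelevance n2_ge2 n2'_ge2); apply: isomorphic_refl.
- have eq_n2 : n2 = n2'.+1 by lia.
  subst n1 n1' n2; apply: isomorphic_trans (kite1_path_graph _ _) _.
  exact/isomorphic_sym/kite2_path_graph.
- have eq_n2 : n2' = n2.+1 by lia.
  subst n1 n1' n2'; apply: isomorphic_trans (kite2_path_graph _ _) _.
  exact/isomorphic_sym/kite1_path_graph.
Qed.
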